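(* The profinite completion $\hat{\mathcal{G}}$ of the Grigorchuk group $\mathcal{G}$ is a $3$-generated pro-$2$ group (generated as a topological group by three elements), and it is not finitely presented as a profinite group.
   Context: Let $X=\{0,1\}$ and let $X^*$ be the set of finite words over $X$, viewed as the binary rooted tree (the root is the empty word, and the children of $w$ are $w0,w1$). The Grigorchuk group $\mathcal{G}\le \mathrm{Aut}(X^* )$ is the group generated by the tree automorphisms $a,b,c,d$ defined recursively for $w\in X^*$ by: $a(0w)=1w$, $a(1w)=0w$; $b(0w)=0\,a(w)$, $b(1w)=1\,c(w)$; $c(0w)=0\,a(w)$, $c(1w)=1\,d(w)$; $d(0w)=0w$, $d(1w)=1\,b(w)$ (all fix the empty word). A profinite group $G$ is finitely presented (as a profinite group) if there is an exact sequence $1\to R\to \hat F\to G\to 1$ of profinite groups, where $\hat F$ is the profinite completion of a free group $F$ of finite rank and $R$ is the closed normal subgroup of $\hat F$ generated by some finite set $\{r_1,\dots,r_m\}\subset R$. *)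

(* Defs.v *)
From HB Require Import structures.
From mathcomp Require Import all_boot.
From mathcomp Require Import all_classical.
From mathcomp Require Import topology.

Set Implicit Arguments.
Unset Strict Implicit.
Unset Printing Implicit Defensive.

Import Algebra.
Local Open Scope classical_set_scope.
Local Open Scope group_scope.
Local Open Scope quotient_scope.
Local Open Scope card_scope.

Definition is_subgroup (G : groupType) (H : set G) : Prop :=
  H 1 /\ forall x y, H x -> H y -> H (x * y^-1).

Definition is_normal (G : groupType) (N : set G) : Prop :=
  is_subgroup N /\ forall x g, N x -> N (x ^ g).

Definition gen_subgroup (G : groupType) (S : set G) : set G :=
  smallest (@is_subgroup G) S.

Lemma gen_subgroupP (G : groupType) (S : set G) : is_subgroup (gen_subgroup S).
Proof.
split=> [H [[H1 _] _] //|x y Sx Sy H HP].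
by have [[_ HD] _] := HP; apply: HD; [exact: Sx | exact: Sy].
Qed.

Lemma is_subgroup_closed (G : groupType) (H : set G) :
  is_subgroup H -> group_closed (mem H).
Proof.
move=> [H1 HF]; split=> [|x y /set_mem Hx /set_mem Hy]; apply/mem_set => //.
exact: HF.
Qed.

Record normalSubgroup (G : groupType) := NormalSubgroup {
  nsg_set :> set G;
  nsgP : is_normal nsg_set }.

Section Quotient.
Variables (G : groupType) (N : normalSubgroup G).

Lemma nsg1 : nsg_set N 1. Proof. by case: N => ? [[]]. Qed.

Lemma nsgF x y : nsg_set N x -> nsg_set N y -> nsg_set N (x * y^-1).
Proof. by case: N => ? [[_ h] _] /=; exact: h. Qed.

Lemma nsgV x : nsg_set N x -> nsg_set N x^-1.
Proof. by move=> Nx; rewrite -[x^-1]mul1g; exact: nsgF nsg1 Nx. Qed.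

Lemma nsgM x y : nsg_set N x -> nsg_set N y -> nsg_set N (x * y).
Proof. by move=> Nx /nsgV Ny; rewrite -[y]invgK; exact: nsgF. Qed.

Lemma nsgJ x g : nsg_set N x -> nsg_set N (x ^ g).
Proof. by case: N => ? [_ h] /=; exact: h. Qed.

Definition coset_rel (x y : G) : bool := `[< nsg_set N (x^-1 * y) >].

Lemma coset_rel_equiv : equiv_class_of coset_rel.
Proof.
split=> [x|x y|y x z].
- by apply/asboolP; rewrite mulVg; exact: nsg1.
- apply/asbool_equiv_eq; split=> /nsgV; by rewrite invgM invgK.
- move=> /asboolP h1 /asboolP h2; apply/asboolP.
  by have := nsgM h1 h2; rewrite mulgA mulgK.
Qed.

Canonical coset_equiv := EquivRelPack coset_rel_equiv.

Definition quotg := {eq_quot coset_equiv}.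

HB.instance Definition _ := Choice.on quotg.
HB.instance Definition _ := EqQuotient.on quotg.

Definition quotg_pi (x : G) : quotg := \pi_quotg x.
Definition quotg_mul (p q : quotg) : quotg := quotg_pi (repr p * repr q).
Definition quotg_one : quotg := quotg_pi 1.
Definition quotg_inv (p : quotg) : quotg := quotg_pi (repr p)^-1.

Lemma quotg_eqP (x y : G) :
  (quotg_pi x = quotg_pi y) <-> nsg_set N (x^-1 * y).
Proof.
split; first by move=> /eqquotP /asboolP.
by move=> h; apply/eqquotP/asboolP.
Qed.

Lemma quotg_reprK (q : quotg) : quotg_pi (repr q) = q.
Proof. exact: reprK. Qed.

Lemma repr_quotg (x : G) : nsg_set N ((repr (quotg_pi x))^-1 * x).
Proof. by apply/quotg_eqP; rewrite quotg_reprK. Qed.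

Lemma quotg_surj (q : quotg) : exists x, q = quotg_pi x.
Proof. by exists (repr q); rewrite quotg_reprK. Qed.

Lemma quotg_piM (x y : G) :
  quotg_mul (quotg_pi x) (quotg_pi y) = quotg_pi (x * y).
Proof.
apply/quotg_eqP; set x' := repr (quotg_pi x); set y' := repr (quotg_pi y).
have -> : (x' * y')^-1 * (x * y) = (x'^-1 * x) ^ y' * (y'^-1 * y).
  by rewrite /conjg invgM !mulgA mulgK.
by apply: nsgM; [apply: nsgJ|]; exact: repr_quotg.
Qed.

Lemma quotg_piV (x : G) : quotg_inv (quotg_pi x) = quotg_pi x^-1.
Proof.
apply/quotg_eqP; set x' := repr (quotg_pi x); rewrite invgK.
have -> : x' * x^-1 = ((x'^-1 * x) ^ x^-1)^-1.
  by rewrite /conjg invgK !invgM !invgK !mulgA mulgV mul1g.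
by apply/nsgV/nsgJ; exact: repr_quotg.
Qed.

Lemma quotg_mulA : associative quotg_mul.
Proof.
move=> p q r; have [x ->] := quotg_surj p; have [y ->] := quotg_surj q.
have [z ->] := quotg_surj r.
by rewrite (quotg_piM y z) (quotg_piM x y) 2!quotg_piM mulgA.
Qed.
Lemma quotg_mul1 : left_id quotg_one quotg_mul.
Proof. by move=> p; have [x ->] := quotg_surj p; rewrite quotg_piM mul1g. Qed.
Lemma quotg_mulr1 : right_id quotg_one quotg_mul.
Proof. by move=> p; have [x ->] := quotg_surj p; rewrite quotg_piM mulg1. Qed.
Lemma quotg_mulV : left_inverse quotg_one quotg_inv quotg_mul.
Proof.
by move=> p; have [x ->] := quotg_surj p; rewrite quotg_piV quotg_piM mulVg.
Qed.
Lemma quotg_mulVr : right_inverse quotg_one quotg_inv quotg_mul.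
Proof.
by move=> p; have [x ->] := quotg_surj p; rewrite quotg_piV quotg_piM mulgV.
Qed.

HB.instance Definition _ := isGroup.Build quotg
  quotg_mulA quotg_mul1 quotg_mulr1 quotg_mulV quotg_mulVr.

HB.instance Definition _ := isUMagmaMorphism.Build G quotg quotg_pi
  (conj erefl (fun x y => esym (quotg_piM x y))).

End Quotient.

(* The canonical map [G / M -> G / N]; meaningful when [M `<=` N]. *)
Definition quotg_proj (G : groupType) (M N : normalSubgroup G)
  (q : quotg M) : quotg N := quotg_pi N (repr q).

Lemma quotg_projE (G : groupType) (M N : normalSubgroup G) (x : G) :
  nsg_set M `<=` nsg_set N -> quotg_proj N (quotg_pi M x) = quotg_pi N x.
Proof. by move=> MN; apply/quotg_eqP/MN; exact: repr_quotg. Qed.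

Lemma quotg_projF (G : groupType) (M N : normalSubgroup G) (p q : quotg M) :
  nsg_set M `<=` nsg_set N ->
  quotg_proj N (p / q) = quotg_proj N p / quotg_proj N q.
Proof.
move=> MN; have [x ->] := quotg_surj p; have [y ->] := quotg_surj q.
by rewrite -gmulfF !quotg_projE // gmulfF.
Qed.

HB.mixin Record isTopGroup G of Group G & Topological G := {
  mulg_continuous : continuous (fun xy : G * G => xy.1 * xy.2);
  invg_continuous : continuous (fun x : G => x^-1) }.

#[short(type="topGroupType")]
HB.structure Definition TopGroup := {G of Group G & Topological G & isTopGroup G}.

Definition profinite (G : topGroupType) : Prop :=
  [/\ compact [set: G], hausdorff_space G & totally_disconnected [set: G]].

Definition pro_p (p : nat) (G : topGroupType) : Prop :=
  profinite G /\
  forall N : normalSubgroup G, open (nsg_set N) ->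
    exists k : nat, [set: quotg N] #= `I_(p ^ k).

(* The [n] generators need not be distinct. *)
Definition top_generated (n : nat) (G : topGroupType) : Prop :=
  exists g : 'I_n -> G, closure (gen_subgroup (range g)) = [set: G].

Definition closed_normal_closure (G : topGroupType) (S : set G) : set G :=
  smallest (fun N : set G => is_normal N /\ closed N) S.

Record finIndexNormal (G : groupType) := FinIndexNormal {
  fin_nsg :> normalSubgroup G;
  fin_nsgP : finite_set [set: quotg fin_nsg] }.

Section Completion.
Variable G : groupType.

Definition finite_quotients : Type :=
  prod_topology (fun N : finIndexNormal G => discrete_topology (quotg N)).

HB.instance Definition _ := Topological.on finite_quotients.

Definition fq_mul (x y : finite_quotients) : finite_quotients :=
  fun N => (x N : quotg N) * (y N : quotg N).
Definition fq_one : finite_quotients := fun N => (1 : quotg N).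
Definition fq_inv (x : finite_quotients) : finite_quotients :=
  fun N => (x N : quotg N)^-1.

Lemma fq_mulA : associative fq_mul.
Proof. by move=> x y z; apply/functional_extensionality_dep => N; exact: mulgA. Qed.
Lemma fq_mul1 : left_id fq_one fq_mul.
Proof. by move=> x; apply/functional_extensionality_dep => N; exact: mul1g. Qed.
Lemma fq_mulr1 : right_id fq_one fq_mul.
Proof. by move=> x; apply/functional_extensionality_dep => N; exact: mulg1. Qed.
Lemma fq_mulV : left_inverse fq_one fq_inv fq_mul.
Proof. by move=> x; apply/functional_extensionality_dep => N; exact: mulVg. Qed.
Lemma fq_mulVr : right_inverse fq_one fq_inv fq_mul.
Proof. by move=> x; apply/functional_extensionality_dep => N; exact: mulgV. Qed.

HB.instance Definition _ := isGroup.Build finite_quotients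
  fq_mulA fq_mul1 fq_mulr1 fq_mulV fq_mulVr.

(* Compatibility with the projections [G / M -> G / N] cuts the inverse limit of
   the finite quotients of [G] out of their product. *)
Definition compatible : set finite_quotients :=
  [set x | forall M N : finIndexNormal G, nsg_set M `<=` nsg_set N ->
     quotg_proj N (x M : quotg M) = (x N : quotg N)].

Definition profinite_completion : Type := set_type compatible.

HB.instance Definition _ := SubChoice.on profinite_completion.
HB.instance Definition _ := Topological.on profinite_completion.

Lemma compatible_subgroup : is_subgroup compatible.
Proof.
split=> [M N MN|x y cx cy M N MN]; first exact: quotg_projE.
apply: etrans (quotg_projF (x M : quotg M) (y M : quotg M) MN) _.
by rewrite (cx M N MN) (cy M N MN).
Qed.

HB.instance Definition _ := SubChoice_isSubGroup.Build
  finite_quotients (mem compatible) profinite_completion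
  (is_subgroup_closed compatible_subgroup).

Lemma near_coord (x : profinite_completion) (N : finIndexNormal G) :
  \forall y \near x, val y N = val x N.
Proof.
have cv : {for x, continuous (val : profinite_completion -> finite_quotients)}.
  exact: initial_continuous.
suff /cv : nbhs (val x) [set y : finite_quotients | y N = val x N] by [].
have /cvg_sup/(_ N) : val x --> val x by exact: cvg_id.
apply; exists [set y : finite_quotients | y N = val x N]; split=> //.
by exists [set val x N] => //; exact: discrete_open.
Qed.

Lemma continuous_coord (T : topologicalType) (f : T -> profinite_completion) :
  (forall t N, \forall u \near t, val (f u) N = val (f t) N) -> continuous f.
Proof.
move=> ft; apply: continuous_comp_initial => t.
apply/cvg_sup => N A [_ [[B Bop <-] Bft sBA]].
by apply: filterS (ft t N) => u e; apply: sBA; exact: (eq_ind_r B Bft e).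
Qed.

Lemma completion_mul_continuous :
  continuous (fun xy : profinite_completion * profinite_completion =>
    xy.1 * xy.2).
Proof.
apply: continuous_coord => -[x y] N.
exists ([set u | val u N = val x N], [set u | val u N = val y N]) => /=.
  by split; exact: near_coord.
move=> [u v] /= [eu ev].
exact: (congr2 (fun p q : quotg N => p * q) eu ev).
Qed.

Lemma completion_inv_continuous :
  continuous (fun x : profinite_completion => x^-1).
Proof.
apply: continuous_coord => x N.
apply: filterS (near_coord x N) => y e.
exact: (congr1 (fun q : quotg N => q^-1) e).
Qed.

HB.instance Definition _ := isTopGroup.Build profinite_completion
  completion_mul_continuous completion_inv_continuous.

End Completion.

Section FreeGroup.
Variable n : nat.

(* [(i, false)] stands for the i-th generator and [(i, true)] for its inverse. *)
Definition letter : Type := ('I_n * bool)%type.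
Implicit Types (x y : letter) (u v w : seq letter).

Definition letter_inv x : letter := (x.1, ~~ x.2).

Definition reduced w : bool := sorted (fun x y => y != letter_inv x) w.

Definition cons_red x w : seq letter :=
  if w is y :: w' then if y == letter_inv x then w' else x :: w else [:: x].

Definition mul_red u v : seq letter := foldr cons_red v u.

Lemma letter_invK : involutive letter_inv.
Proof. by move=> [i e]; rewrite /letter_inv /= negbK. Qed.

Lemma reduced_behead x w : reduced (x :: w) -> reduced w.
Proof. by case: w => //= y w /andP[]. Qed.

Lemma cons_red_reduced x w : reduced w -> reduced (cons_red x w).
Proof.
case: w => //= y w; case: ifP => [_|/negbT yx] rw; first exact: reduced_behead rw.
by rewrite /= yx.
Qed.

Lemma mul_red_reduced u v : reduced v -> reduced (mul_red u v).
Proof. by move=> rv; elim: u => //= x u; exact: cons_red_reduced. Qed.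

Lemma cons_redK x w : reduced w -> cons_red x (cons_red (letter_inv x) w) = w.
Proof.
case: w => [_|y w] /=; first by rewrite eqxx.
rewrite letter_invK; case: eqVneq => [->|yx] /= rw; last by rewrite eqxx.
by case: w rw => //= z w /andP[/negbTE -> _].
Qed.

Lemma cons_redVK x w : reduced w -> cons_red (letter_inv x) (cons_red x w) = w.
Proof. by move=> rw; rewrite -{2}[x]letter_invK cons_redK. Qed.

Lemma cons_redE x w : reduced (x :: w) -> cons_red x w = x :: w.
Proof. by case: w => //= y w /andP[/negbTE -> _]. Qed.

Lemma mul_cons_red x u v : reduced u -> reduced v ->
  mul_red (cons_red x u) v = cons_red x (mul_red u v).
Proof.
case: u => //= y u; case: eqVneq => //= -> ru rv.
by rewrite cons_redK // mul_red_reduced.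
Qed.

Lemma mul_redA u v w : reduced u -> reduced v -> reduced w ->
  mul_red u (mul_red v w) = mul_red (mul_red u v) w.
Proof.
move=> + rv rw; elim: u => //= x u IH /reduced_behead ru.
by rewrite IH // mul_cons_red // mul_red_reduced.
Qed.

Lemma mul_red0 u : reduced u -> mul_red u [::] = u.
Proof.
elim: u => //= x u IH ru; rewrite IH; last exact: reduced_behead ru.
exact: cons_redE.
Qed.

Definition inv_red u : seq letter := rev (map letter_inv u).

Lemma inv_red_reduced u : reduced u -> reduced (inv_red u).
Proof.
rewrite /reduced /inv_red rev_sorted sorted_map; apply: sub_sorted => x y /=.
by rewrite letter_invK eq_sym (can2_eq letter_invK letter_invK).
Qed.

Lemma inv_redK : involutive inv_red.
Proof.
by move=> u; rewrite /inv_red map_rev revK -map_comp map_id_in // => x _;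
  exact: letter_invK.
Qed.

Lemma mul_redV u : mul_red (inv_red u) u = [::].
Proof.
elim: u => //= x u IH; rewrite /inv_red /= rev_cons /mul_red foldr_rcons /=.
by rewrite letter_invK eqxx.
Qed.

Definition free_group : Type := {w : seq letter | reduced w}.
HB.instance Definition _ := SubChoice.on free_group.

Definition free_mul (u v : free_group) : free_group :=
  exist _ (mul_red (val u) (val v)) (mul_red_reduced (val u) (valP v)).
Definition free_one : free_group := exist _ [::] isT.
Definition free_inv (u : free_group) : free_group :=
  exist _ (inv_red (val u)) (inv_red_reduced (valP u)).

Lemma free_mulA : associative free_mul.
Proof. by move=> u v w; apply/val_inj/mul_redA; exact: valP. Qed.
Lemma free_mul1 : left_id free_one free_mul.
Proof. by move=> u; exact: val_inj. Qed.
Lemma free_mulr1 : right_id free_one free_mul.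
Proof. by move=> u; apply/val_inj/mul_red0/valP. Qed.
Lemma free_mulV : left_inverse free_one free_inv free_mul.
Proof. by move=> u; apply/val_inj/mul_redV. Qed.
Lemma free_mulVr : right_inverse free_one free_inv free_mul.
Proof.
by move=> u; apply/val_inj; rewrite /= -{1}[val u]inv_redK; exact: mul_redV.
Qed.

HB.instance Definition _ := isGroup.Build free_group
  free_mulA free_mul1 free_mulr1 free_mulV free_mulVr.

Definition free_gen (i : 'I_n) : free_group := exist _ [:: (i, false)] isT.

Lemma free_group_univ (H : groupType) (f : 'I_n -> H) :
  exists! phi : free_group -> H,
    {morph phi : x y / x * y} /\ forall i, phi (free_gen i) = f i.
Proof.
pose ev x := if x.2 then (f x.1)^-1 else f x.1.
pose lift w := foldr (fun x h => ev x * h) 1 w.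
have evV x : ev x * ev (letter_inv x) = 1.
  by case: x => i [] /=; rewrite /ev /= ?mulVg ?mulgV.
have liftC x w : lift (cons_red x w) = ev x * lift w.
  case: w => //= y w; case: eqVneq => //= ->.
  by rewrite mulgA evV mul1g.
have liftM u v : lift (mul_red u v) = lift u * lift v.
  by elim: u => [|x u IH] /=; rewrite ?mul1g // liftC IH mulgA.
exists (fun w : free_group => lift (val w)); split.
  by split=> [u v|i]; [exact: liftM | rewrite /= /ev mulg1].
move=> psi [psiM psif]; apply/funext => -[w rw] /=.
have psi1 : psi 1 = 1.
  by apply: (mulgI (psi 1)); rewrite -psiM mulg1 mulg1.
elim: w rw => [|x w IH] rw; first by apply: etrans (esym psi1) _; congr psi; exact: val_inj.
have rw' := reduced_behead rw.
rewrite /= (IH rw').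
have -> : exist _ (x :: w) rw =
    (exist _ [:: x] isT : free_group) * (exist _ w rw' : free_group).
  by apply: val_inj => /=; rewrite cons_redE.
rewrite psiM; congr (_ * _).
case: x {rw} => i [] /=; rewrite /ev /= -psif //.
apply: (mulgI (psi (free_gen i))); rewrite mulgV -psiM -psi1; congr psi.
by apply: val_inj; rewrite /= eqxx.
Qed.

End FreeGroup.

(* An exact sequence [1 -> R -> F^ -> G -> 1] with [R] a closed normal subgroup
   of the profinite group [F^] is given by a continuous epimorphism
   [phi : F^ -> G] with kernel [R]. *)
Definition finitely_presented (G : topGroupType) : Prop :=
  exists (n : nat)
         (phi : UMagmaMorphism.type (profinite_completion (free_group n)) G)
         (S : set (profinite_completion (free_group n))),
    [/\ continuous phi, range phi = [set: G], finite_set S &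
        phi @^-1` [set 1] = closed_normal_closure S].

(* Words are read from the root, so the children of [w] are [rcons w x]. *)
Definition is_tree_aut (f : seq bool -> seq bool) : Prop :=
  [/\ bijective f, f [::] = [::] &
      forall w x, exists y, f (rcons w x) = rcons (f w) y].

Definition tree_aut : Type := set_type is_tree_aut.
HB.instance Definition _ := SubChoice.on tree_aut.

Lemma is_tree_aut_id : is_tree_aut id.
Proof. by split=> [|//|w x]; [exact: (Bijective (g := id)) | exists x]. Qed.

Lemma is_tree_aut_comp f g :
  is_tree_aut f -> is_tree_aut g -> is_tree_aut (f \o g).
Proof.
move=> [bf f0 fc] [bg g0 gc]; split=> [||w x]; first exact: bij_comp.
- by rewrite /= g0.
- by have [y /= ->] := gc w x; exact: fc.
Qed.

Lemma is_tree_aut_inv f : is_tree_aut f ->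
  exists g, [/\ is_tree_aut g, cancel f g & cancel g f].
Proof.
move=> [bf f0 fc]; have [g fK gK] := bf; exists g; split=> //; split.
- by exists f.
- by rewrite -f0 fK.
move=> w x; have injf := can_inj fK.
case/lastP E : (g (rcons w x)) => [|u y].
  by have := gK (rcons w x); rewrite E f0; case: (w).
have [z fz] := fc u y.
have := gK (rcons w x); rewrite E fz => /rcons_inj[<- _].
by exists y; rewrite fK.
Qed.

Definition tree_mul (f g : tree_aut) : tree_aut :=
  SigSub (mem_set (is_tree_aut_comp (set_valP f) (set_valP g))).
Definition tree_one : tree_aut := SigSub (mem_set is_tree_aut_id).
Definition tree_inv (f : tree_aut) : tree_aut :=
  let g := cid (is_tree_aut_inv (set_valP f)) in
  SigSub (mem_set (let: And3 tg _ _ := svalP g in tg)).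

Lemma tree_mulA : associative tree_mul.
Proof. by move=> f g h; exact: val_inj. Qed.
Lemma tree_mul1 : left_id tree_one tree_mul.
Proof. by move=> f; exact: val_inj. Qed.
Lemma tree_mulr1 : right_id tree_one tree_mul.
Proof. by move=> f; exact: val_inj. Qed.
Lemma tree_mulV : left_inverse tree_one tree_inv tree_mul.
Proof.
move=> f; apply: val_inj; rewrite /=; case: cid => g [? fK gK] /=.
by apply/funext => w; exact: fK.
Qed.
Lemma tree_mulVr : right_inverse tree_one tree_inv tree_mul.
Proof.
move=> f; apply: val_inj; rewrite /=; case: cid => g [? fK gK] /=.
by apply/funext => w; exact: gK.
Qed.

HB.instance Definition _ := isGroup.Build tree_aut
  tree_mulA tree_mul1 tree_mulr1 tree_mulV tree_mulVr.

Definition grig_a_fun (w : seq bool) : seq bool :=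
  if w is x :: w' then ~~ x :: w' else [::].

(* The letters 0 and 1 are [false] and [true]. *)
Fixpoint grig_b_fun (w : seq bool) : seq bool :=
  match w with
  | [::] => [::]
  | false :: w' => false :: grig_a_fun w'
  | true :: w' => true :: grig_c_fun w'
  end
with grig_c_fun (w : seq bool) : seq bool :=
  match w with
  | [::] => [::]
  | false :: w' => false :: grig_a_fun w'
  | true :: w' => true :: grig_d_fun w'
  end
with grig_d_fun (w : seq bool) : seq bool :=
  match w with
  | [::] => [::]
  | false :: w' => false :: w'
  | true :: w' => true :: grig_b_fun w'
  end.

Lemma grig_a_tree_aut : is_tree_aut grig_a_fun.
Proof.
have aK : involutive grig_a_fun by case=> //= x w; rewrite negbK.
split=> //; first exact: inv_bij.
by case=> [|z w] x; [exists (~~ x) | exists x].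
Qed.

Lemma grig_bcdK :
  [/\ involutive grig_b_fun, involutive grig_c_fun & involutive grig_d_fun].
Proof.
have aK : involutive grig_a_fun by case=> //= x w; rewrite negbK.
have H w : [/\ grig_b_fun (grig_b_fun w) = w, grig_c_fun (grig_c_fun w) = w
              & grig_d_fun (grig_d_fun w) = w].
  by elim: w => // -[] w [IHb IHc IHd] /=; rewrite ?aK ?IHb ?IHc ?IHd.
by split=> w; have [] := H w.
Qed.

Lemma grig_bcd_rcons w x :
  [/\ exists y, grig_b_fun (rcons w x) = rcons (grig_b_fun w) y,
      exists y, grig_c_fun (rcons w x) = rcons (grig_c_fun w) y
    & exists y, grig_d_fun (rcons w x) = rcons (grig_d_fun w) y].
Proof.
have [_ _ ha] := grig_a_tree_aut.
elim: w => [|z w [[y1 e1] [y2 e2] [y3 e3]]].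
  by split; exists x; case: x.
have [y0 e0] := ha w x; case: z; split => /=.
- by exists y2; rewrite e2.
- by exists y3; rewrite e3.
- by exists y1; rewrite e1.
- by exists y0; rewrite e0.
- by exists y0; rewrite e0.
- by exists x.
Qed.

Lemma grig_b_tree_aut : is_tree_aut grig_b_fun.
Proof.
have [bK _ _] := grig_bcdK; split=> // [|w x]; first exact: inv_bij.
by have [] := grig_bcd_rcons w x.
Qed.

Lemma grig_c_tree_aut : is_tree_aut grig_c_fun.
Proof.
have [_ cK _] := grig_bcdK; split=> // [|w x]; first exact: inv_bij.
by have [] := grig_bcd_rcons w x.
Qed.

Lemma grig_d_tree_aut : is_tree_aut grig_d_fun.
Proof.
have [_ _ dK] := grig_bcdK; split=> // [|w x]; first exact: inv_bij.
by have [] := grig_bcd_rcons w x.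
Qed.

Definition grig_a : tree_aut := SigSub (mem_set grig_a_tree_aut).
Definition grig_b : tree_aut := SigSub (mem_set grig_b_tree_aut).
Definition grig_c : tree_aut := SigSub (mem_set grig_c_tree_aut).
Definition grig_d : tree_aut := SigSub (mem_set grig_d_tree_aut).

Definition grigorchuk_set : set tree_aut :=
  gen_subgroup [set grig_a; grig_b; grig_c; grig_d].

Definition grigorchuk : Type := set_type grigorchuk_set.
HB.instance Definition _ := SubChoice.on grigorchuk.
HB.instance Definition _ := SubChoice_isSubGroup.Build
  tree_aut (mem grigorchuk_set) grigorchuk
  (is_subgroup_closed (gen_subgroupP _)).

(* Main.v *)
From HB Require Import structures.
Require Import Defs.
From mathcomp Require Import all_fingroup all_solvable finmap.
From mathcomp Require Import all_boot all_classical topology.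

Set Implicit Arguments.
Unset Strict Implicit.
Unset Printing Implicit Defensive.

Import Algebra.
Local Open Scope group_scope.

(* The Grigorchuk group G is a 2-group (torsion), so by Cauchy's theorem its
   finite quotients are 2-groups.

   Non-presentability. For each k, let the words in a, b, c, d act on the tree
   down to level k and then on a copy of Z/16 attached to each vertex of level
   k, through the dihedral group of order 32 in which d is trivial and b = c. A
   word that is trivial on level k + 5 only shifts the copies of Z/16 by
   multiples of 8. The number of nonzero shifts modulo 2 gives a central
   extension, with kernel of order 2, of a finite quotient of G. Given a
   presentation F^ -> G^, lift it to each of these extensions; this yields
   invariant homomorphisms chi_k from its kernel R to Z/2. If R were generated by
   m elements as a closed normal subgroup, chi_k would be determined by its
   values on them, so that chi_k = chi_l for some k < l. But the k-th Lysenok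
   relator sigma^k((ac)^8), which can be evaluated in F^ through arbitrary
   preimages of a, b, c, d because it is a square, satisfies chi_k = 1 and
   chi_l = 0 for all l > k. *)

(** * Words and torsion *)

Inductive gen := A | B | C | D.

Definition eq_gen (s t : gen) : bool :=
  match s, t with A, A | B, B | C, C | D, D => true | _, _ => false end.

Lemma eq_genP : Equality.axiom eq_gen.
Proof. by do 2!case; constructor. Qed.

HB.instance Definition _ := hasDecEq.Build gen eq_genP.

Section Words.
Implicit Types (s t : gen) (u v w : seq gen) (x : bool) (p : seq bool).

Definition isA s := s == A.

(** The wreath recursion a = swap, b = (a, c), c = (a, d), d = (1, b), with sections written as
    words. *)
Definition sec1 s x : seq gen :=
  match s, x with
  | A, _ | D, false => [::]
  | B, false | C, false => [:: A]
  | B, true => [:: C]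
  | C, true => [:: D]
  | D, true => [:: B]
  end.

Definition par w : bool := foldr (fun s e => isA s (+) e) false w.

(* The letters of a word act from right to left, as in [tree_mul]. *)
Fixpoint sec w x : seq gen :=
  if w is s :: w' then sec1 s (x (+) par w') ++ sec w' x else [::].

Definition gen_fun s : seq bool -> seq bool :=
  match s with
  | A => grig_a_fun | B => grig_b_fun | C => grig_c_fun | D => grig_d_fun
  end.

Definition word_fun w p : seq bool := foldr gen_fun p w.

Lemma par_cat u v : par (u ++ v) = par u (+) par v.
Proof. by elim: u => //= s u ->; rewrite addbA. Qed.

Lemma sec_cat u v x : sec (u ++ v) x = sec u (x (+) par v) ++ sec v x.
Proof.
by elim: u => //= s u ->; rewrite par_cat catA [par u (+) _]addbC addbA.
Qed.

Lemma word_fun_cat u v p : word_fun (u ++ v) p = word_fun u (word_fun v p).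
Proof. exact: foldr_cat. Qed.

Lemma gen_fun_cons s x p :
  gen_fun s (x :: p) = (x (+) isA s) :: word_fun (sec1 s x) p.
Proof. by case: s; case: x. Qed.

Lemma word_fun_nil w : word_fun w [::] = [::].
Proof. by elim: w => //= s w ->; case: s. Qed.

Lemma word_fun_cons w x p :
  word_fun w (x :: p) = (x (+) par w) :: word_fun (sec w x) p.
Proof.
elim: w => [|s w IH] /=; first by rewrite addbF.
by rewrite IH gen_fun_cons word_fun_cat addbAC addbA.
Qed.

Lemma gen_funK s : involutive (gen_fun s).
Proof.
have [bK cK dK] := grig_bcdK.
by case: s => //=; case=> //= x p; rewrite negbK.
Qed.

Lemma word_funK w : cancel (word_fun w) (word_fun (rev w)).
Proof.
elim: w => //= s w IH p.
by rewrite rev_cons -cats1 word_fun_cat /= gen_funK IH.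
Qed.

Lemma word_funVK w : cancel (word_fun (rev w)) (word_fun w).
Proof. by move=> p; rewrite -{1}[w]revK word_funK. Qed.

Lemma size_word_fun w p : size (word_fun w p) = size p.
Proof. by elim: p w => [|x p IH] w; rewrite ?word_fun_nil ?word_fun_cons //= IH. Qed.

(** Products in the Klein four-group {1, b, c, d}, together with aa = 1. The value is meaningless
    when exactly one letter is [A]. *)
Definition klein s t : seq gen :=
  match s, t with
  | B, C | C, B => [:: D] | C, D | D, C => [:: B] | D, B | B, D => [:: C]
  | _, _ => [::]
  end.

Lemma grig_relations p :
  [/\ grig_b_fun (grig_c_fun p) = grig_d_fun p,
      grig_c_fun (grig_d_fun p) = grig_b_fun p &
      grig_d_fun (grig_b_fun p) = grig_c_fun p].
Proof.
have aK := gen_funK A.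
elim: p => // -[] p [h1 h2 h3] /=; rewrite ?h1 ?h2 ?h3 //.
by rewrite [grig_a_fun _]aK.
Qed.

Lemma word_fun_klein s t p : isA s = isA t ->
  word_fun [:: s; t] p = word_fun (klein s t) p.
Proof.
have [bK cK dK] := grig_bcdK.
have [h1 h2 h3] := grig_relations p.
case: s; case: t => //= _; rewrite ?bK ?cK ?dK //.
- exact: (gen_funK A).
- by have [_ e _] := grig_relations (grig_d_fun p); rewrite -e dK.
- by have [_ _ e] := grig_relations (grig_b_fun p); rewrite -e bK.
- by have [e _ _] := grig_relations (grig_c_fun p); rewrite -e cK.
Qed.

Definition torsion2 w := exists j : nat, forall p, iter (2 ^ j)%N (word_fun w) p = p.

Lemma iter_id (T : Type) (f : T -> T) (m n : nat) :
  (forall y, iter m f y = y) -> forall y, iter (n * m)%N f y = y.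
Proof. by move=> h; elim: n => //= n IH y; rewrite mulSn iterD IH h. Qed.

(** The two words are conjugate by [v]. *)
Lemma torsion2_rot u v : torsion2 (u ++ v) -> torsion2 (v ++ u).
Proof.
move=> [j h]; exists j => p; rewrite -[p](word_funVK v).
have := h (word_fun (rev v) p); set q := word_fun _ _ => hq.
rewrite -[in RHS]hq; elim: (2 ^ j)%N => //= n ->.
by rewrite !word_fun_cat.
Qed.

Lemma torsion2_ext u v : word_fun u =1 word_fun v -> torsion2 u -> torsion2 v.
Proof. by move=> e [j h]; exists j => p; rewrite -[RHS]h; apply/esym/eq_iter. Qed.

Lemma torsion2_sec w :
  ~~ par w -> torsion2 (sec w false) -> torsion2 (sec w true) -> torsion2 w.
Proof.
move=> /negbTE pw [j0 h0] [j1 h1]; exists (j0 + j1)%N; case=> [|x p].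
  by elim: (2 ^ _)%N => //= n ->; exact: word_fun_nil.
have -> n : iter n (word_fun w) (x :: p) = x :: iter n (word_fun (sec w x)) p.
  by elim: n => //= n ->; rewrite word_fun_cons pw addbF.
by congr cons; case: x; rewrite expnD; [|rewrite mulnC]; exact: iter_id.
Qed.

Lemma torsion2_square w : torsion2 (w ++ w) -> torsion2 w.
Proof.
move=> [j h]; exists j.+1 => p; rewrite expnS mulnC iterM -[RHS]h.
by apply: eq_iter => q /=; rewrite word_fun_cat.
Qed.

(* For [w] of odd parity, the sections of [w ++ w] are rotations of this word. *)
Definition double_sec w := sec w false ++ sec w true.

Lemma torsion2_odd w : par w -> torsion2 (double_sec w) -> torsion2 w.
Proof.
move=> pw h; apply/torsion2_square/torsion2_sec; rewrite ?sec_cat ?par_cat pw //=.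
exact: torsion2_rot.
Qed.

Lemma size_sec w x : size (sec w x) <= count (predC isA) w.
Proof.
elim: w => //= s w IH; rewrite size_cat leq_add //.
by case: s; case: (_ (+) _).
Qed.

(** Each b or c contributes a letter to both sections, each d to only one of them. *)
Lemma size_double_sec w :
  (size (double_sec w) + count (pred1 D) w = (count (predC isA) w).*2)%N.
Proof.
rewrite /double_sec size_cat; elim: w => //= s w IH.
rewrite !size_cat doubleD -IH (addnACA (size _)) addnACA; congr (_ + _)%N.
by case: s; case: (par w).
Qed.

Lemma mem_double_sec w :
  (C \in double_sec w) = (B \in w) /\ (D \in double_sec w) = (C \in w).
Proof.
rewrite /double_sec !mem_cat; elim: w => //= s w [e1 e2].
by rewrite !mem_cat !inE -e1 -e2; case: s; case: (par w); split; rewrite //= ?orbT.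
Qed.

Definition alt (xs : seq gen) : seq gen := flatten [seq [:: A; s] | s <- xs].

Lemma alt_size xs : size (alt xs) = (size xs).*2.
Proof. by elim: xs => //= s xs ->. Qed.

Lemma alt_count xs : all (predC isA) xs -> count (predC isA) (alt xs) = size xs.
Proof. by elim: xs => //= s xs IH /andP[-> /IH->]. Qed.

Definition switch s t := isA s != isA t.

Lemma not_sorted (T : Type) (e : rel T) (w : seq T) : ~~ sorted e w ->
  exists (u v : seq T) (s t : T), w = u ++ [:: s, t & v] /\ ~~ e s t.
Proof.
elim: w => // s [|t w] //= IH; case: (boolP (e s t)) => [_ /IH|est _].
  by move=> [u [v [s' [t' [-> h]]]]]; exists (s :: u), v, s', t'.
by exists [::], w, s, t.
Qed.

Lemma sorted_alt w : sorted switch w -> isA (head B w) -> ~~ isA (last A w) ->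
  exists2 xs, all (predC isA) xs & w = alt xs.
Proof.
have [n] := ubnP (size w); elim: n w => // n IH [|s [|t w]] //=.
  by move=> _ _ ->.
move=> sn /andP[st ptw] hs hl; have nt : ~~ isA t.
  by move: st; rewrite /switch hs; case: (isA t).
have sA : s = A by apply/eqP.
case: w sn ptw hl => [_ _ _|y w sn /= /andP[ty pyw] hl].
  by exists [:: t]; rewrite /= ?nt ?sA.
have [||||xs axs e] := IH (y :: w) => //.
- by move: sn; rewrite /= !ltnS => /ltnW.
- by move: ty => /=; rewrite /switch (negbTE nt); case: (isA y).
by exists (t :: xs); rewrite /= ?nt // e sA.
Qed.

(** Cyclic reduction in the free product of {1, a} and {1, b, c, d}: unless two cyclically adjacent
    letters lie in the same factor, some rotation alternates. *)
Lemma cyclic_form w :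
  [\/ size w <= 1,
      exists u v s t z,
        [/\ w = u ++ v, v ++ u = [:: s, t & z] & isA s = isA t] |
      exists u v xs, [/\ w = u ++ v, v ++ u = alt xs & all (predC isA) xs]].
Proof.
case: (boolP (sorted switch w)) => [|/not_sorted]; last first.
  move=> [u [v [s [t [-> /negPn/eqP h]]]]]; constructor 2.
  by exists u, [:: s, t & v], s, t, (v ++ u).
case: w => [|s w]; first by constructor 1.
case/lastP: w => [|w t]; first by constructor 1.
move=> sw; have [st|st] := eqVneq (isA t) (isA s).
  constructor 2; exists (s :: w), [:: t], t, s, w; split=> //.
  by rewrite -cats1.
constructor 3; case hs: (isA s) st => st.
  have [||] := sorted_alt sw; rewrite /= ?last_rcons ?hs //.
    by move: st; case: (isA t).
  by move=> xs axs e; exists [::], (s :: rcons w t), xs; rewrite cats0.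
have [|||] := @sorted_alt [:: t, s & w].
- move: sw; rewrite /= rcons_path => /andP[-> _].
  by rewrite /switch hs andbT; move: st; case: (isA t).
- by move: st => /=; case: (isA t).
- move: sw; rewrite /= rcons_path => /andP[_]; rewrite /switch.
  by move: st; case: (isA t) => // _; case: (isA (last s w)).
move=> xs axs e; exists (s :: w), [:: t], xs; split=> //.
by rewrite -cats1.
Qed.

(** Merging two adjacent letters shortens a word, and the sections of an alternating word have at
    most half its length. This settles all but the alternating words of odd parity, left to the last
    hypothesis; [perm_eq] and the count are all that it retains of the alternating rotation. *)
Lemma torsion2_step n w :
  (forall v, size v < n -> torsion2 v) -> size w <= n ->
  (forall v, perm_eq v w -> (count (predC isA) v).*2 = size v ->
     torsion2 (double_sec v)) ->
  torsion2 w.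
Proof.
move=> IH wn hodd; case: (cyclic_form w) => [|[u [v [s [t [z [e e' st]]]]]]|].
- case: w {wn hodd} => [|s [|//]] _; first by exists 0%N.
  by exists 1%N => p /=; rewrite gen_funK.
- rewrite e; apply: torsion2_rot; rewrite e'.
  have sz : size w = (size z).+2 by rewrite e size_cat addnC -size_cat e'.
  apply: (@torsion2_ext (klein s t ++ z)) => [p|].
    by rewrite word_fun_cat -word_fun_klein.
  apply: IH; rewrite size_cat; apply: leq_trans wn; rewrite sz !ltnS.
  by rewrite -add1n leq_add2r; case: (s); case: (t).
move=> [u [v [xs [e e' axs]]]]; rewrite e; apply: torsion2_rot.
have pvu : perm_eq (v ++ u) w by rewrite e perm_catC.
case: (boolP (par (v ++ u))) => [pw|pw].
  apply: torsion2_odd => //; apply: hodd => //.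
  by rewrite e' alt_count // alt_size.
(* The empty word is set apart because its sections are not shorter. *)
have [xs0|xs0] := posnP (size xs).
  by rewrite e' (size0nil xs0); exists 0%N.
have lt x : size (sec (v ++ u) x) < n.
  apply: leq_ltn_trans (size_sec _ _) _; apply: leq_trans wn.
  by rewrite -(perm_size pvu) e' alt_count // alt_size -addnn -addn1 leq_add2l.
by apply: torsion2_sec => //; exact: IH.
Qed.

(* On a cyclically alternating word, [double_sec] does not increase the length,
   and decreases it if the letter [d] occurs; it turns [b] into [c] and [c] into
   [d], so that at most three steps suffice. *)
Lemma torsion2_word w : torsion2 w.
Proof.
have [n] := ubnP (size w); elim: n w => // n IH w; rewrite ltnS.
have bound v : (count (predC isA) v).*2 = size v ->
    size (double_sec v) = (size v - count (pred1 D) v)%N.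
  by move=> <-; rewrite -size_double_sec addnK.
have hD v : D \in v -> size v <= n -> torsion2 v.
  move=> Dv sv; apply: (torsion2_step IH sv) => z pz hz; apply: IH.
  rewrite bound //; apply: leq_trans sv; rewrite -(perm_size pz) ltn_subrL.
  rewrite -has_count has_pred1 (perm_mem pz) Dv /=.
  by rewrite (perm_size pz); case: (v) Dv.
have hC v : C \in v -> size v <= n -> torsion2 v.
  move=> Cv sv; apply: (torsion2_step IH sv) => z pz hz; apply: hD.
    by rewrite (mem_double_sec z).2 (perm_mem pz).
  by rewrite bound //; apply: leq_trans sv; rewrite -(perm_size pz) leq_subr.
move=> sw; apply: (torsion2_step IH sw) => z pz hz.
have sz : size (double_sec z) <= n.
  by rewrite bound //; apply: leq_trans sw; rewrite -(perm_size pz) leq_subr.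
have [Dz|Dz] := boolP (D \in z).
  by apply: IH; rewrite bound //; apply: leq_trans sw;
    rewrite -(perm_size pz) ltn_subrL -has_count has_pred1 Dz; case: (z) Dz.
have [Cz|Cz] := boolP (C \in z); first by apply: hD; rewrite ?(mem_double_sec z).2.
have [Bz|Bz] := boolP (B \in z); first by apply: hC; rewrite ?(mem_double_sec z).1.
suff -> : double_sec z = [::] by exists 0%N.
apply/size0nil/eqP; rewrite -leqn0; apply: leq_trans (leq_addr (count (pred1 D) z) _) _.
rewrite size_double_sec leqn0 double_eq0 -leqn0 leqNgt -has_count.
by apply/hasPn => -[] //= zt; rewrite ?zt in Bz Cz Dz.
Qed.

Definition gen_aut s : tree_aut :=
  match s with A => grig_a | B => grig_b | C => grig_c | D => grig_d end.

Lemma gen_aut_grig s : grigorchuk_set (gen_aut s).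
Proof.
by move=> H [_]; apply; case: s; [left; left; left | left; left; right
  | left; right | right].
Qed.

Definition grig_gen s : grigorchuk := SigSub (mem_set (gen_aut_grig s)).

Definition ev w : grigorchuk := foldr (fun s g => grig_gen s * g) 1 w.

Lemma ev_cat u v : ev (u ++ v) = ev u * ev v.
Proof. by elim: u => [|s u IH] /=; rewrite ?mul1g // IH mulgA. Qed.

Definition grig_fun (g : grigorchuk) : seq bool -> seq bool := val (val g).

Lemma grig_funP (g h : grigorchuk) : grig_fun g =1 grig_fun h -> g = h.
Proof. by move=> e; do 2!apply: val_inj; apply/funext. Qed.

Lemma grig_funM (g h : grigorchuk) p : grig_fun (g * h) p = grig_fun g (grig_fun h p).
Proof. by []. Qed.

Lemma grig_funV (g : grigorchuk) p : grig_fun g^-1 (grig_fun g p) = p.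
Proof. by rewrite -grig_funM mulVg. Qed.

Lemma grig_fun_gen s : grig_fun (grig_gen s) = gen_fun s.
Proof. by case: s. Qed.

Lemma grig_fun_ev w : grig_fun (ev w) = word_fun w.
Proof.
apply/funext => p; elim: w => //= s w IH.
by rewrite grig_funM IH grig_fun_gen.
Qed.

Lemma ev_rev w : ev (rev w) = (ev w)^-1.
Proof.
apply: (mulIg (ev w)); rewrite mulVg -ev_cat; apply: grig_funP => p.
by rewrite grig_fun_ev word_fun_cat word_funK.
Qed.

Lemma ev_surj (g : grigorchuk) : exists w, g = ev w.
Proof.
suff [w e] : exists w, val g = val (ev w) by exists w; exact: val_inj.
(* A generated subgroup is an intersection of subgroups, here tested on the subgroup of elements
   represented by words. *)
apply: (set_valP g [set h : tree_aut | exists w, h = val (ev w)]%classic); split.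
  split=> [|_ _ [u ->] [v ->]]; first by exists [::].
  by exists (u ++ rev v); rewrite ev_cat ev_rev.
by move=> h [[[]|]|] ->; [exists [:: A] | exists [:: B] | exists [:: C]
  | exists [:: D]]; apply: val_inj.
Qed.

Lemma grig_torsion2 (g : grigorchuk) : exists j : nat, g ^+ (2 ^ j)%N = 1.
Proof.
have [w ->] := ev_surj g; have [j h] := torsion2_word w; exists j.
apply: grig_funP => p; rewrite -[RHS]h -grig_fun_ev.
by elim: (2 ^ j)%N => //= n IH; rewrite expgS grig_funM IH.
Qed.

Lemma size_grig_fun (g : grigorchuk) p : size (grig_fun g p) = size p.
Proof. by have [w ->] := ev_surj g; rewrite grig_fun_ev size_word_fun. Qed.

End Words.

(** * Profinite completions *)

Local Open Scope classical_set_scope.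
Local Open Scope card_scope.
Local Open Scope group_scope.

Section FiniteIndex.
Variable G : groupType.

Lemma finite_quotg (T : Type) (f : G -> T) (N : normalSubgroup G) :
  finite_set [set: T] -> (forall x y, f x = f y -> nsg_set N (x^-1 * y)) ->
  finite_set [set: quotg N].
Proof.
move=> finT fN; rewrite -(preimage_setT (f \o repr)).
apply: finite_preimage finT => p q _ _ /fN/quotg_eqP.
by rewrite !quotg_reprK.
Qed.

Lemma normalI (M N : normalSubgroup G) : is_normal (M `&` N).
Proof.
split; last by move=> x g [Mx Nx]; split; exact: nsgJ.
split; first by split; exact: nsg1.
by move=> x y [Mx Nx] [My Ny]; split; exact: nsgF.
Qed.

Lemma finIndexI (M N : finIndexNormal G) :
  exists L : finIndexNormal G, nsg_set L = M `&` N.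
Proof.
pose L := NormalSubgroup (normalI M N).
suff fL : finite_set [set: quotg L] by exists (FinIndexNormal fL).
apply: (@finite_quotg _ (fun x => (quotg_pi M x, quotg_pi N x))) => [|x y].
  by rewrite -setXTT; apply: finite_setX; exact: fin_nsgP.
by move=> -[/quotg_eqP ? /quotg_eqP ?].
Qed.

Lemma finIndexT : exists N : finIndexNormal G, nsg_set N = [set: G].
Proof.
have nT : is_normal [set: G] by [].
suff fT : finite_set [set: quotg (NormalSubgroup nT)] by exists (FinIndexNormal fT).
exact: (@finite_quotg unit (fun=> tt)).
Qed.

Definition completion_of_compat (g : G) : compatible (fun N : finIndexNormal G => quotg_pi N g).
Proof. by move=> M N MN; exact: quotg_projE. Qed.

Definition to_completion (g : G) : profinite_completion G :=
  SigSub (mem_set (completion_of_compat g)).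

Lemma to_completion_morphism :
  to_completion 1 = 1 /\ {morph to_completion : g h / g * h}.
Proof.
split=> [|g h]; apply: val_inj; apply: functional_extensionality_dep => N //=.
by rewrite gmulfM.
Qed.

HB.instance Definition _ := isUMagmaMorphism.Build G (profinite_completion G)
  to_completion to_completion_morphism.

Implicit Types x y : profinite_completion G.

(** The topology is induced from a product of discrete spaces, so convergence is tested on each
    coordinate. *)
Lemma completion_cvg (F : set_system (profinite_completion G)) x :
  Filter F ->
  (forall N : finIndexNormal G, F [set y | val y N = val x N]) -> F --> x.
Proof.
move=> FF Fx; have Fv : val @ F --> val x.
  apply/cvg_sup => N V [_ [[W Wop <-] xW WV]].
  suff : F (val @^-1` V) by [].
  by apply: filterS (Fx N) => y yx; apply: WV; exact: (eq_ind_r W xW yx).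
move=> V [_ [[W Wop <-] xW]] /filterS; apply; apply: Fv.
exact: open_nbhs_nbhs.
Qed.

(** One coordinate suffices: normal subgroups of finite index are stable under intersection, and by
    compatibility the coordinate at [M] [&] [N] determines those at [M] and [N]. *)
Lemma completion_nbhs x (U : set (profinite_completion G)) :
  nbhs x U -> exists N : finIndexNormal G, [set y | val y N = val x N] `<=` U.
Proof.
pose F : set_system (profinite_completion G) := [set V |
  exists N : finIndexNormal G, [set y | val y N = val x N] `<=` V].
have FF : Filter F.
  split=> [|V W [M MV] [N NW]|V W VW [N NV]].
  - by have [N _] := finIndexT; exists N.
  - have [L LMN] := finIndexI M N; exists L => y yL.
    have [LM LN] : nsg_set L `<=` M /\ nsg_set L `<=` N by rewrite LMN; split=> ? [].
    have hy := set_valP y; have hx := set_valP x.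
    split; [apply: MV => /=|apply: NW => /=].
      by rewrite -(hy L M LM) -(hx L M LM) yL.
    by rewrite -(hy L N LN) -(hx L N LN) yL.
  - by exists N; exact: subset_trans VW.
suff : F --> x by apply.
by apply: completion_cvg => N; exists N.
Qed.

Lemma completion_dense (x : profinite_completion G) (U : set (profinite_completion G)) :
  nbhs x U -> exists g, U (to_completion g).
Proof.
move=> /completion_nbhs [N NU]; have [g e] := quotg_surj (val x N : quotg N).
by exists g; apply: NU; rewrite /= e.
Qed.

Lemma completion_coord_open (N : finIndexNormal G) (P : set (quotg N)) :
  open [set y : profinite_completion G | P (val y N)].
Proof.
rewrite openE => x Px; apply: filterS (near_coord x N) => y.
by rewrite /= => ->.
Qed.

Lemma completion_neq x y : x <> y -> exists N : finIndexNormal G, val x N <> val y N.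
Proof.
move=> xy; apply/existsNP => h; apply: xy; apply: val_inj.
exact: functional_extensionality_dep.
Qed.

Lemma completion_zero_dimensional : zero_dimensional (profinite_completion G).
Proof.
move=> x y /eqP/completion_neq[N xyN].
exists [set z | val z N = val x N]; split=> //; last exact: nesym.
split; first exact: (@completion_coord_open N [set val x N]).
rewrite -[X in closed X]setCK; apply: open_closedC.
exact: (@completion_coord_open N (~` [set val x N])).
Qed.

Lemma completion_hausdorff : hausdorff_space (profinite_completion G).
Proof.
move=> x y xy; apply: contrapT => /completion_neq[N]; apply.
by have [z [<- <-]] := xy _ _ (near_coord x N) (near_coord y N).
Qed.

(** Along an ultrafilter each coordinate, having finitely many values, is eventually constant. The
    limit is compatible since any two of its coordinates are shared with some element of the
    completion. *)
Lemma completion_compact : compact [set: profinite_completion G].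
Proof.
rewrite compact_ultra => F FU _.
have ultra_coord (N : finIndexNormal G) : exists q : quotg N,
    F [set y | val y N = q].
  apply: contrapT => /forallNP hN.
  have {}hN q : F [set y | val y N <> q].
    by have [/hN|] := in_ultra_setVsetC [set y | val y N = q] FU.
  have /finite_fsetP[X XT] := fin_nsgP N.
  have : F (\bigcap_(q in [set` X]) [set y | val y N <> q]).
    by apply: filter_bigI => q _; exact: hN.
  move=> /filter_ex[y /(_ (val y N))]; apply=> //.
  by rewrite -XT.
pose z : finite_quotients G := fun N => sval (cid (ultra_coord N)).
have Fz N : F [set y | val y N = z N] := svalP (cid (ultra_coord N)).
have cz : compatible z.
  move=> M N MN.
  have : F ([set y | val y M = z M] `&` [set y | val y N = z N]).
    exact: filterI.
  move=> /filter_ex[y [/= <- <-]].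
  exact: set_valP y M N MN.
exists (SigSub (mem_set cz)); split=> //.
exact: completion_cvg.
Qed.

Lemma completion_profinite : profinite (profinite_completion G).
Proof.
split; [exact: completion_compact | exact: completion_hausdorff |].
exact/zero_dimension_totally_disconnected/completion_zero_dimensional.
Qed.

End FiniteIndex.

(** * Torsion groups and pro-p completions *)

Lemma p_torsion_finite_card (p : nat) (H : groupType) : prime p ->
  finite_set [set: H] -> (forall h : H, exists j : nat, h ^+ (p ^ j)%N = 1) ->
  exists k : nat, [set: H] #= `I_(p ^ k).
Proof.
move=> pp /finite_fsetP[X XT] tors.
have inX (h : H) : h \in X by move: (I : [set: H] h); rewrite XT.
(* The enumeration [X] is used to equip [H] with a [finGroupType] structure, to which Cauchy's
   theorem applies. *)
pose f h : X := [` inX h]%fset.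
have fK : cancel f val by [].
pose c := Choice_isCountable.Build H (pcan_pickleK (can_pcan fK)).
pose cH : countType := HB.pack (Group.sort H) c.
pose i := @CanIsFinite cH _ f _ fK.
pose fH : finGroupType := HB.pack (Group.sort H) c i.
have : p.-nat #|fH|.
  apply/pnatP=> [|q pq]; first by apply/card_gt0P; exists 1.
  rewrite -cardsT => /(Cauchy pq)[x _ xq]; have [j xj] := tors x.
  have : #[x] %| p ^ j by rewrite order_dvdn; apply/eqP; exact: xj.
  by rewrite xq Euclid_dvdX // dvdn_prime2 // => /andP[].
move=> /p_natP[k hk]; exists k.
rewrite XT -hk; apply/card_eq_fsetP; rewrite cardfE.
symmetry; apply: (@bij_eq_card fH X f).
by exists val => // y; apply: val_inj.
Qed.

Lemma completion_pro_p (p : nat) (G : groupType) : prime p ->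
  (forall g : G, exists j : nat, g ^+ (p ^ j)%N = 1) ->
  pro_p p (profinite_completion G).
Proof.
move=> pp tors; split; first exact: completion_profinite.
move=> N Nop; have N1 : nbhs (1 : profinite_completion G) (nsg_set N).
  by rewrite nbhsE; exists (nsg_set N) => //; split=> //; exact: nsg1.
have [L LN] := completion_nbhs N1; apply: p_torsion_finite_card => // [|q].
  apply: (finite_quotg (f := fun y : profinite_completion G => val y L : quotg L)).
    exact: fin_nsgP.
  move=> x y e; apply: LN.
  have : (val x L : quotg L)^-1 * (val y L : quotg L) = 1 by rewrite e mulVg.
  by [].
have [y ->] := quotg_surj q.
(* By density each coset of [N] meets the image of [G], whose elements have p-power order. *)
have [g Ng] : exists g, nsg_set N (y^-1 * to_completion g).
  apply: (completion_dense (x := y) (U := [set z | nsg_set N (y^-1 * z)])).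
  apply: filterS (near_coord y L) => z e; apply: LN.
  have : (val y L : quotg L)^-1 * (val z L : quotg L) = 1 by rewrite e mulVg.
  by [].
have [j gj] := tors g; exists j.
have /quotg_eqP -> := Ng.
by rewrite -!gmulfXn gj !gmulf1.
Qed.

(** * Finite central extensions of quotients of G *)

Section Tower.
Local Open Scope nat_scope.
Implicit Types (s t : gen) (u v w : seq gen) (x : bool) (p : seq bool).

Definition level_trivial n w := forall p, size p = n -> word_fun w p = p.

Lemma level_trivial_sec n w x : level_trivial n.+1 w ->
  par w = false /\ level_trivial n (sec w x).
Proof.
move=> tw; split=> [|p pn].
  by have := tw (nseq n.+1 false) (size_nseq _ _); rewrite word_fun_cons => -[].
have /(tw (x :: p)) : size (x :: p) = n.+1 by rewrite /= pn.
by rewrite word_fun_cons => -[].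
Qed.

Definition ord16 (m : nat) : 'I_16 := Ordinal (ltn_pmod m (isT : 0 < 16)).

Lemma all_ord16 (P : pred 'I_16) :
  all (fun m => P (ord16 m)) (iota 0 16) -> forall j, P j.
Proof.
move=> /allP h j; have -> : j = ord16 j by apply: val_inj; rewrite /= modn_small.
by apply: h; rewrite mem_iota /=.
Qed.

(* The reflections [j |-> -1-j] and [j |-> -j] of Z/16. *)
Definition base_gen s (j : 'I_16) : 'I_16 :=
  match s with A => ord16 (15 - j) | B | C => ord16 (16 - j) | D => j end.

(* The dihedral quotients of G are related by taking sections: if Z/16 is
   identified with {0,1} x Z/8 by [base_vertex], then [base_gen] acts as a swap
   composed with the action [base_sec_gen] of the sections, ... *)
Definition base_sec_gen s (j : 'I_16) : 'I_16 :=
  match s with A => ord16 (15 - j) | C | D => ord16 (16 - j) | B => j end.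

Definition base_vertex x (j : 'I_16) : 'I_16 :=
  if x then ord16 (2 * j) else ord16 (31 - 2 * j).

(* ... and modulo 4, with Z/4 identified with {0,1} x Z/2 by [base_residue],
   [base_sec_gen] acts through the parity of the letters [b] and [d] in the
   sections. *)
Definition base_residue x (e : bool) : nat := if x then 3 - 2 * e else 2 * e.

Definition base_word w (j : 'I_16) : 'I_16 := foldr base_gen j w.
Definition base_sec_word w (j : 'I_16) : 'I_16 := foldr base_sec_gen j w.
Definition parity (P : pred gen) w := foldr (fun s e => P s (+) e) false w.

Lemma parity_cat P u v : parity P (u ++ v) = parity P u (+) parity P v.
Proof. by elim: u => //= s u ->; rewrite addbA. Qed.

Lemma base_word_vertex w x j :
  base_word w (base_vertex x j) = base_vertex (x (+) par w) (base_sec_word (sec w x) j).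
Proof.
have gen_vertex s y i : base_gen s (base_vertex y i) =
    base_vertex (y (+) isA s) (base_sec_word (sec1 s y) i).
  apply/eqP; move: i; apply: all_ord16.
  by case: s; case: y; vm_compute.
elim: w => [|s w IH] /=; first by rewrite addbF.
by rewrite IH gen_vertex /base_sec_word foldr_cat addbAC addbA.
Qed.

Lemma base_sec_word_residue w x e (j : 'I_16) : j %% 4 = base_residue x e ->
  base_sec_word w j %% 4 =
    base_residue (x (+) par w) (e (+) parity (pred2 B D) (sec w x)).
Proof.
move=> je; have gen_residue s y c (i : 'I_16) : i %% 4 = base_residue y c ->
    base_sec_gen s i %% 4 =
      base_residue (y (+) isA s) (c (+) parity (pred2 B D) (sec1 s y)).
  move=> /eqP h; apply/eqP; move: h; apply/implyP; move: i.
  by apply: all_ord16; case: s; case: y; case: c; vm_compute.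
elim: w => [|s w IH] /=; first by rewrite !addbF.
rewrite (gen_residue s _ _ _ IH) parity_cat.
by rewrite [parity _ (sec1 _ _) (+) _]addbC addbA addbAC addbA.
Qed.

(** Passing to sections turns the parity of b and d into that of b and c, and the latter into that
    of a, which is visible on the first level. Hence level 3 detects the parity of b and d. *)
Lemma parity_sec w :
  parity (pred2 B D) w = parity (pred2 B C) (sec w false ++ sec w true) /\
  parity (pred2 B C) w = par (sec w false ++ sec w true).
Proof.
rewrite parity_cat par_cat; elim: w => //= s w [-> ->].
rewrite !parity_cat !par_cat.
move: (parity _ (sec w false)) (parity _ (sec w true)) => p0 p1.
move: (par (sec w false)) (par (sec w true)) => q0 q1.
by case: s; case: (par w); case: p0; case: p1; case: q0; case: q1.
Qed.

Lemma level_trivial_parity w : level_trivial 3 w -> parity (pred2 B D) w = false.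
Proof.
move=> w3; rewrite (parity_sec w).1 parity_cat.
suff h x : parity (pred2 B C) (sec w x) = false by rewrite !h.
have [_ w2] := level_trivial_sec x w3.
rewrite (parity_sec (sec w x)).2 par_cat.
have h y : par (sec (sec w x) y) = false.
  have [_ w1] := level_trivial_sec y w2.
  by have [-> _] := level_trivial_sec true w1.
by rewrite !h.
Qed.

(** Of the five levels, one is spent on the sections in [base_vertex], one on those in
    [base_residue], and three on [level_trivial_parity]. *)
Lemma base_word_mod8 w j : level_trivial 5 w -> base_word w j = j %[mod 8].
Proof.
move=> w5; have [x [i ->]] : exists x i, j = base_vertex x i.
  (* Inverse of [base_vertex]: even residues are 2i, odd ones -1 - 2i. *)
  exists (~~ odd j), (ord16 (if odd j then (31 - j)./2 else j./2)).
  by apply/eqP; move: j; apply: all_ord16; vm_compute.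
have [pw w4] := level_trivial_sec x w5.
rewrite base_word_vertex pw addbF.
have : base_sec_word (sec w x) i %% 4 = i %% 4.
  have ie : i %% 4 = base_residue (odd i) (i %% 4 == if odd i then 1 else 2).
    by apply/eqP; move: (i); apply: all_ord16; vm_compute.
  rewrite (base_sec_word_residue _ ie).
  have [-> w3] := level_trivial_sec (odd i) w4.
  by rewrite level_trivial_parity // !addbF -ie.
move: (base_sec_word _ _) {pw w4} => i' /eqP h; apply/eqP; move: h; apply/implyP.
move: i'; apply: all_ord16; move: i; apply: all_ord16.
by case: x; vm_compute.
Qed.

Definition affine (e : bool) (r j : 'I_16) : 'I_16 :=
  ord16 (if e then r + (16 - j) else r + j).

Definition shift8 (e : bool) (j : 'I_16) : 'I_16 := ord16 (j + 8 * e).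

Lemma base_word_affine w : exists e r, base_word w =1 affine e r.
Proof.
elim: w => [|s w [e [r IH]]].
  by exists false, (ord16 0); move=> j; apply/eqP; move: j; apply: all_ord16.
exists (e (+) (s != D)), (match s with A => ord16 (15 - r) | D => r | _ => ord16 (16 - r) end).
move=> j; rewrite /= IH; apply/eqP; move: j; apply: all_ord16; move: r {IH}; apply: all_ord16.
by case: s; case: e; vm_compute.
Qed.

(** An affine map j |-> r + j or r - j that fixes 0 and 1 modulo 8 is a shift by 0 or 8. *)
Lemma base_word_shift w : level_trivial 5 w -> exists e, base_word w =1 shift8 e.
Proof.
move=> w5; have [e [r wE]] := base_word_affine w.
exists (r == ord16 8) => j; rewrite wE.
have /eqP := base_word_mod8 (ord16 1) w5; have /eqP := base_word_mod8 (ord16 0) w5.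
rewrite !wE => h0 h1; apply/eqP.
have := introT andP (conj h0 h1); apply/implyP; move: r {wE h0 h1}.
apply: all_ord16; move: j; apply: all_ord16.
by case: e; vm_compute.
Qed.

(** * Action on the copies of Z/16 over level k *)

Fixpoint fibre k : finType := if k is k'.+1 then (bool * fibre k')%type else 'I_16.

Fixpoint tower_gen k s : fibre k -> fibre k :=
  match k return fibre k -> fibre k with
  | 0 => base_gen s
  | k'.+1 => fun z => (z.1 (+) isA s, foldr (@tower_gen k') z.2 (sec1 s z.1))
  end.

Definition tower_word k w (z : fibre k) : fibre k := foldr (tower_gen (k := k)) z w.

(* [tower_shift e f]: over each vertex of level [k], [f] shifts the fibre by a
   multiple of 8, and the number of nonzero shifts has parity [e]. *)
Fixpoint tower_shift k (e : bool) : (fibre k -> fibre k) -> Prop :=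
  match k return (fibre k -> fibre k) -> Prop with
  | 0 => fun f => f =1 shift8 e
  | k'.+1 => fun f => exists (g : bool -> fibre k' -> fibre k') (h : bool -> bool),
      [/\ forall x z, f (x, z) = (x, g x z), forall x, tower_shift (h x) (g x)
        & e = h false (+) h true]
  end.

Lemma tower_word_cat k u v (z : fibre k) :
  tower_word (u ++ v) z = tower_word u (tower_word v z).
Proof. exact: foldr_cat. Qed.

Lemma tower_word_cons k w x (z : fibre k) :
  tower_word (k := k.+1) w (x, z) = (x (+) par w, tower_word (sec w x) z).
Proof.
elim: w => [|s w IH] /=; first by rewrite addbF.
by rewrite IH /= -/(tower_word _ _) -tower_word_cat addbAC addbA.
Qed.

Lemma tower_genK k s : involutive (tower_gen (k := k) s).
Proof.
elim: k s => [|k IH] s /=.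
  by move=> j; apply/eqP; move: j; apply: all_ord16; case: s; vm_compute.
by move=> [x z] /=; rewrite -addbA addbb addbF; case: s; case: x; rewrite //= IH.
Qed.

Lemma tower_wordK k w : cancel (tower_word (k := k) w) (tower_word (rev w)).
Proof.
elim: w => //= s w IH z.
by rewrite rev_cons -cats1 tower_word_cat /= tower_genK IH.
Qed.

Lemma tower_shift_ext k e (f g : fibre k -> fibre k) :
  f =1 g -> tower_shift e f -> tower_shift e g.
Proof. by move=> /funext->. Qed.

Lemma tower_shift_id k : tower_shift false (@id (fibre k)).
Proof.
elim: k => [|k IH] /=.
  by move=> j; apply/eqP; move: j; apply: all_ord16.
by exists (fun=> id), (fun=> false).
Qed.

Lemma tower_shift_comp k e e' (f g : fibre k -> fibre k) :
  tower_shift e f -> tower_shift e' g -> tower_shift (e (+) e') (f \o g).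
Proof.
elim: k e e' f g => [|k IH] e e' f g /=.
  move=> hf hg j /=; rewrite hf hg; apply/eqP; move: j; apply: all_ord16.
  by case: e {hf}; case: e' {hg}; vm_compute.
move=> [F [h [hF sF ->]]] [F' [h' [hF' sF' ->]]].
exists (fun x => F x \o F' x), (fun x => h x (+) h' x); split.
- by move=> x z; rewrite /= hF' hF.
- by move=> x; exact: IH.
- by rewrite addbACA.
Qed.

Fixpoint fibre0 k : fibre k :=
  if k is k'.+1 return fibre k then (false, fibre0 k') else ord16 0.

Lemma tower_shift_inj k e e' (f : fibre k -> fibre k) :
  tower_shift e f -> tower_shift e' f -> e = e'.
Proof.
elim: k e e' f => [|k IH] e e' f /=.
  by move=> h /(_ (ord16 0)); rewrite h => /(congr1 val); case: e {h}; case: e'.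
move=> [F [h [hF sF ->]]] [F' [h' [hF' sF' ->]]].
suff hh' x : h x = h' x by rewrite !hh'.
apply: (IH _ _ (F x)) => //; apply: tower_shift_ext (sF' x) => z.
by have := hF' x z; rewrite hF => -[].
Qed.

Lemma tower_shiftK k e (f : fibre k -> fibre k) : tower_shift e f -> involutive f.
Proof.
elim: k e f => [|k IH] e f /=.
  move=> h j; rewrite !h; apply/eqP; move: j; apply: all_ord16.
  by case: e {h}; vm_compute.
by move=> [F [h [hF sF _]]] [x z]; rewrite !hF (IH _ _ (sF x)).
Qed.

(** Conjugation permutes the vertices of level [k], and the shift by 8 commutes with the dihedral
    action, so the number of nonzero shifts is unchanged. This makes chi_k invariant. *)
Lemma tower_shift_conj k e s (f : fibre k -> fibre k) :
  tower_shift e f -> tower_shift e (tower_gen s \o f \o tower_gen s).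
Proof.
elim: k e s f => [|k IH] e s f /=.
  move=> h j; rewrite /= h; apply/eqP; move: j; apply: all_ord16.
  by case: e {h}; case: s; vm_compute.
move=> [F [h [hF sF ->]]].
exists (fun x => tower_word (sec1 s (x (+) isA s)) \o F (x (+) isA s) \o tower_word (sec1 s x)).
exists (fun x => h (x (+) isA s)); split.
- by move=> x z /=; rewrite hF /= -addbA addbb addbF.
- move=> x; case: s; case: x => //=; try exact: IH; exact: sF.
- by case: (isA s); rewrite // addbC.
Qed.

Lemma tower_shift_level k w : level_trivial (5 + k) w ->
  exists e, tower_shift e (tower_word (k := k) w).
Proof.
elim: k w => [|k IH] w; first exact: base_word_shift.
rewrite addnS => tw.
have pw : par w = false by have [] := level_trivial_sec true tw.
have hw x : exists e, tower_shift e (tower_word (k := k) (sec w x)).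
  by apply: IH; have [] := level_trivial_sec x tw.
have [h sh] := choice hw.
exists (h false (+) h true), (fun x => tower_word (sec w x)), h; split=> //.
by move=> x z; rewrite tower_word_cons pw addbF.
Qed.

(** The action on [fibre k] covers the action on level [k], so large [k] suffice. This is how the
    relators are seen to be trivial in the Grigorchuk group. *)
Lemma word_fun_tower n w p :
  (forall k, n < k -> tower_word (k := k) w =1 id) -> word_fun w p = p.
Proof.
elim: p w => [|x p IH] w wk; first exact: word_fun_nil.
have hk k z : n < k -> (x (+) par w, tower_word (k := k) (sec w x) z) = (x, z).
  by move=> nk; rewrite -tower_word_cons wk // ltnW.
have [xw _] := hk n.+1 (fibre0 _) (ltnSn n).
rewrite word_fun_cons xw IH // => k nk z.
by have [_ ->] := hk k z nk.
Qed.

(** * Lysenok's relators *)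

Definition flat_subst (f : gen -> seq gen) w := flatten (map f w).

(* Lysenok's substitution: [theta w] and [w] are the sections of [sigma w]. *)
Definition sigma := flat_subst (fun s =>
  match s with A => [:: A; C; A] | B => [:: D] | C => [:: B] | D => [:: C] end).
Definition theta := flat_subst (fun s =>
  match s with A => [:: D] | B => [::] | C | D => [:: A] end).

Lemma flat_subst_cat f u v : flat_subst f (u ++ v) = flat_subst f u ++ flat_subst f v.
Proof. by rewrite /flat_subst map_cat flatten_cat. Qed.

Lemma par_sigma w : par (sigma w) = false.
Proof. by elim: w => //= s w IH; rewrite /sigma /flat_subst /= par_cat IH; case: s. Qed.

Lemma sec_sigma w x : sec (sigma w) x = if x then w else theta w.
Proof.
elim: w => [|s w IH]; first by case: x.
rewrite -[s :: w]/([:: s] ++ w) /sigma /theta !flat_subst_cat sec_cat -/sigma IH par_sigma addbF.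
by case: s; case: x {IH}.
Qed.

Definition relator k := iter k sigma (flatten (nseq 8 [:: A; C])).

Lemma relator_square k : exists v, relator k = v ++ v.
Proof.
elim: k => [|k [v IH]]; first by exists (flatten (nseq 4 [:: A; C])).
by exists (sigma v); rewrite /relator /= -/(relator k) IH /sigma flat_subst_cat.
Qed.

(** After cancelling squares of letters, the composite substitution kills a and d and sends b and c
    to a. *)
Lemma tower_theta_sigma2 k w (z : fibre k) :
  tower_word (theta (sigma (sigma w))) z =
  if parity (pred2 B C) w then tower_gen A z else z.
Proof.
elim: w z => [|s w IH] z //=.
rewrite -[s :: w]/([:: s] ++ w) /sigma /theta !flat_subst_cat tower_word_cat.
rewrite -/sigma -/theta IH.
by case: s => /=; case: (parity _ w); rewrite /= ?tower_genK.
Qed.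

(** For [n = 0] the word is (da)^8, which acts as a^8 on Z/16 and has sections b^4; for [n = 1] it
    is (dad)^8. Later relators are squares, hence contain b and c an even number of times in all. *)
Lemma tower_theta_relator k n (z : fibre k) : tower_word (theta (relator n)) z = z.
Proof.
case: n => [|[|n]].
- case: k z => [|k] z; first by apply/eqP; move: z; apply: all_ord16; vm_compute.
  by case: z => x z; rewrite tower_word_cons; case: x => /=; rewrite !tower_genK.
- by rewrite /= !tower_genK.
have [v rv] := relator_square n.
rewrite -[relator n.+2]/(sigma (sigma (relator n))) tower_theta_sigma2.
by rewrite rv parity_cat addbb.
Qed.

(** The sections of (ac)^8 are (ad)^4 or (da)^4. These are trivial on Z/16, where d is trivial and a
    is an involution, and their own sections are b^2. *)
Lemma tower_relator_id n k (z : fibre k) : n < k -> tower_word (relator n) z = z.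
Proof.
elim: n k z => [|n IH] [|k] // [x z] nk.
  rewrite tower_word_cons; case: k z {nk} => [|k] z.
    by congr pair; [case: x|apply/eqP; move: z; apply: all_ord16; case: x; vm_compute].
  case: z => y z; rewrite !tower_word_cons.
  by case: x; case: y => /=; rewrite !tower_genK.
rewrite tower_word_cons par_sigma addbF sec_sigma.
by case: x; rewrite ?tower_theta_relator // IH.
Qed.

(** On Z/16 the product ac is the shift by -1, so (ac)^8 is the shift by 8. Each [sigma] moves the
    relator below vertex 1 and acts trivially below vertex 0: exactly one vertex carries a nonzero
    shift. *)
Lemma tower_relator_shift k : tower_shift true (tower_word (k := k) (relator k)).
Proof.
elim: k => [|k IH] /=.
  by move=> j; apply/eqP; move: j; apply: all_ord16; vm_compute.
exists (fun x => if x then tower_word (relator k) else id), id; split=> //.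
  move=> x z; rewrite tower_word_cons par_sigma addbF sec_sigma.
  by case: x => //; rewrite tower_theta_relator.
by case=> //; exact: tower_shift_id.
Qed.

Lemma word_fun_relator k p : word_fun (relator k) p = p.
Proof. by apply: (@word_fun_tower k) => l kl z; exact: tower_relator_id. Qed.

End Tower.

(** * Lifting presentations *)

Implicit Types (s t : gen) (u v w : seq gen).

Definition level_stab n : set grigorchuk :=
  [set g | forall p, size p = n -> grig_fun g p = p].

Lemma level_stab_normal n : is_normal (level_stab n).
Proof.
split=> [|g h sg p pn]; first split=> [//|g h sg sh p pn].
  by rewrite grig_funM -{1}(sh p pn) grig_funV sg.
by rewrite !grig_funM sg ?grig_funV // size_grig_fun.
Qed.

Lemma level_stab_fin n : finite_set [set: quotg (NormalSubgroup (level_stab_normal n))].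
Proof.
(* Since [grig_fun g] preserves lengths, the default value [q] of [insubd] is never taken. *)
apply: (@finite_quotg _ {ffun n.-tuple bool -> n.-tuple bool}
  (fun g => [ffun q : n.-tuple bool => insubd q (grig_fun g q)])) => // g h gh p pn.
have {}pn : size p == n by exact/eqP.
have := congr1 (fun F : {ffun n.-tuple bool -> n.-tuple bool} => val (F (Tuple pn))) gh.
rewrite !ffunE !val_insubd !size_grig_fun pn /= => e.
by rewrite grig_funM -e grig_funV.
Qed.

Definition level_subgroup n := FinIndexNormal (level_stab_fin n).

Section TowerPerm.
Variable k : nat.
Implicit Types (g h : {perm fibre k}) (e : bool).

Definition tower_gen_perm s : {perm fibre k} := perm (inv_inj (tower_genK (k := k) s)).

Definition tower_perm w : {perm fibre k} :=
  foldr (fun s g => tower_gen_perm s * g) 1 w.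

Lemma tower_perm_cat u v : tower_perm (u ++ v) = tower_perm u * tower_perm v.
Proof. by elim: u => [|s u IH] /=; rewrite ?mul1g // IH mulgA. Qed.

(* Products of permutations are read from left to right. *)
Lemma tower_permE w z : tower_perm w z = tower_word (rev w) z.
Proof.
elim: w z => [|s w IH] z /=; first by rewrite perm1.
by rewrite permM permE IH rev_cons -cats1 tower_word_cat.
Qed.

Lemma tower_gen_permV s : (tower_gen_perm s)^-1 = tower_gen_perm s.
Proof.
apply: (mulgI (tower_gen_perm s)); rewrite mulgV; apply/perm.permP => z.
by rewrite permM !permE tower_genK.
Qed.

Lemma tower_perm_rev w : tower_perm (rev w) = (tower_perm w)^-1.
Proof.
elim: w => [|s w IH]; first by rewrite invg1.
rewrite rev_cons -cats1 tower_perm_cat IH /= invgM mulg1.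
by rewrite tower_gen_permV.
Qed.

Lemma perm_shift1 : tower_shift false (1 : {perm fibre k}).
Proof. by apply: tower_shift_ext (tower_shift_id k) => z; rewrite perm1. Qed.

Lemma perm_shiftM e1 e2 g h : tower_shift e1 g -> tower_shift e2 h ->
  tower_shift (e1 (+) e2) (g * h).
Proof.
move=> sg sh; rewrite addbC; apply: tower_shift_ext (tower_shift_comp sh sg) => z.
by rewrite permM.
Qed.

Lemma perm_shiftV e g : tower_shift e g -> tower_shift e (g^-1 : {perm fibre k})%g.
Proof.
move=> sg; apply: tower_shift_ext (sg) => z; apply: (@perm_inj _ g).
by rewrite (tower_shiftK sg) permKV.
Qed.

Lemma perm_shiftJ e g w : tower_shift e g -> tower_shift e (g ^ tower_perm w).
Proof.
elim: w g => [|s w IH] g sg; first by rewrite /= conjg1.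
rewrite /= conjgM; apply: IH; apply: tower_shift_ext (tower_shift_conj s sg) => z.
by rewrite /conjg tower_gen_permV !permM !permE.
Qed.

Lemma perm_shift_level w : level_stab (5 + k) (ev w) ->
  exists e, tower_shift e (tower_perm w).
Proof.
move=> lw; have [|e se] := @tower_shift_level k (rev w).
  move=> p pn; rewrite -{1}(lw p pn) grig_fun_ev; exact: word_funK.
by exists e; apply: tower_shift_ext se => z; rewrite tower_permE.
Qed.

(** Reversing the word inverts its action, and a shift by multiples of 8 is its own inverse. *)
Lemma perm_shift_relator : tower_shift true (tower_perm (relator k)).
Proof.
have sr := tower_relator_shift k.
apply: tower_shift_ext (sr) => z.
by rewrite tower_permE -{2}(tower_shiftK sr z) tower_wordK.
Qed.

Lemma tower_perm_relator n : (n < k)%N -> tower_perm (relator n) = 1.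
Proof.
move=> nk; apply/perm.permP => z.
by rewrite perm1 tower_permE -{1}[z](tower_relator_id _ nk) tower_wordK.
Qed.
End TowerPerm.

Lemma free_group_ind n (P : set (free_group n)) :
  is_subgroup P -> (forall i, P (free_gen i)) -> forall g, P g.
Proof.
move=> [P1 PF] Pg; have PV x : P x -> P x^-1 by rewrite -[x^-1]mul1g; exact: PF.
have PM x y : P x -> P y -> P (x * y) by move=> Px /PV Py; rewrite -[y]invgK; exact: PF.
case; elim=> [|[i b] w IH] rw;
  first by rewrite (_ : exist _ _ _ = (1 : free_group n)) //; exact: val_inj.
have rw' := reduced_behead rw.
have -> : exist _ ((i, b) :: w) rw =
    (if b then (free_gen i)^-1 else free_gen i) * (exist _ w rw' : free_group n).
  by apply: val_inj; case: b rw => rw; rewrite /= -cons_redE.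
by apply: PM (IH rw'); case: b {rw}; [apply: PV|]; exact: Pg.
Qed.

Section Lift.
Variables (n : nat)
  (phi : UMagmaMorphism.type (profinite_completion (free_group n))
           (profinite_completion grigorchuk)).
Hypothesis cphi : continuous phi.
Implicit Types y : profinite_completion (free_group n).

(** One word represents both [g] and the image of [y] modulo the stabiliser of level 5 + k. By
    [perm_shift_level] this determines [g] up to shifts by multiples of 8. *)
Definition lifts k y (g : {perm fibre k}) : Prop := exists w,
  (val (phi y) (level_subgroup (5 + k)) : quotg (level_subgroup (5 + k)))
    = quotg_pi _ (ev w) /\ g = tower_perm k w.

(** Freeness gives a lift [psi] on the free group. Its image is finite, so it factors through the
    quotient by its kernel, which is one coordinate of the completion. *)
Lemma tower_lift k : exists f : profinite_completion (free_group n) -> {perm fibre k},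
  [/\ {morph f : x y / x * y}, forall x, \forall y \near x, f y = f x
    & forall x, lifts x (f x)].
Proof.
set L := level_subgroup (5 + k).
have genW i : exists w,
    (val (phi (to_completion (free_gen i))) L : quotg L) = quotg_pi L (ev w).
  have [g ->] := quotg_surj (val (phi (to_completion (@free_gen n i))) L : quotg L).
  by have [w ->] := ev_surj g; exists w.
have [W hW] := choice genW.
have [psi [[psiM psiW] _]] := free_group_univ (fun i => tower_perm k (W i)).
have psi1 : psi 1 = 1 by apply: (mulgI (psi 1)); rewrite -psiM !mulg1.
have psiV x : psi x^-1 = (psi x)^-1.
  by apply: (mulgI (psi x)); rewrite -psiM !mulgV.
have kn : is_normal [set x | psi x = 1].
  split=> [|x g /= x1]; last by rewrite /conjg !psiM psiV x1 mul1g mulVg.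
  by split=> // x y /= x1 y1; rewrite psiM psiV x1 y1 invg1 mulg1.
have fk : finite_set [set: quotg (NormalSubgroup kn)].
  apply: (@finite_quotg _ _ psi) => [|x y e]; first exact: finite_finset.
  by rewrite /= psiM psiV e mulVg.
pose K := FinIndexNormal fk.
have psi_repr x : psi (repr (quotg_pi K x)) = psi x.
  have := repr_quotg K x; rewrite /= psiM psiV => h.
  by apply/esym/(mulgI (psi (repr (quotg_pi K x)))^-1); rewrite h mulVg.
pose f y := psi (repr (val y K : quotg K)).
have fiota x : f (to_completion x) = psi x by exact: psi_repr.
exists f; split.
- move=> x y; rewrite /f -psiM -[RHS]psi_repr -quotg_piM !quotg_reprK.
  by [].
- by move=> x; apply: filterS (near_coord x K) => y; rewrite /f => ->.
move=> x.
(* Both sides of [lifts] are locally constant, so [x] may be replaced by a nearby element of the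
   free group. *)
have [g [gx gf]] : exists g, val (phi (to_completion g)) L = val (phi x) L
    /\ f (to_completion g) = f x.
  apply: (completion_dense (x := x)
    (U := [set y | val (phi y) L = val (phi x) L /\ f y = f x])).
  apply: filterI; first exact: (cphi (near_coord (phi x) L)).
  by apply: filterS (near_coord x K) => y; rewrite /f /= => ->.
suff [w [wg wf]] : lifts (to_completion g) (psi g).
  by exists w; rewrite -gx -gf fiota.
move: g {gx gf}; apply: free_group_ind => [|i]; last first.
  by exists (W i); rewrite psiW hW.
split=> [|a b [u [ua uf]] [v [vb vf]]].
  by exists [::]; rewrite psi1 !gmulf1.
exists (u ++ rev v); rewrite psiM psiV uf vf tower_perm_cat tower_perm_rev; split=> //.
rewrite !gmulfF ev_cat ev_rev gmulfF.
exact: (congr2 (fun p q : quotg L => p / q) ua vb).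
Qed.
End Lift.

(** * Failure of finite presentation *)

Lemma seq_repeat (T : finType) (f : nat -> T) : exists i j, (i < j)%N /\ f i = f j.
Proof.
apply: contrapT => h; pose F (i : 'I_#|T|.+1) := f i.
suff /leq_card : injective F by rewrite card_ord ltnn.
move=> i j ij; apply: val_inj; case: (ltngtP i j) => // lt; exfalso; apply: h.
  by exists (val i), (val j).
by exists (val j), (val i).
Qed.

Section NotFinitelyPresented.
Variables (n : nat)
  (phi : UMagmaMorphism.type (profinite_completion (free_group n))
           (profinite_completion grigorchuk)).
Variables (k : nat) (f : profinite_completion (free_group n) -> {perm fibre k}).
Hypotheses (fM : {morph f : x y / x * y}) (fl : forall x, lifts phi x (f x)).
Implicit Types (y : profinite_completion (free_group n)) (e : bool).

Let f1 : f 1 = 1.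
Proof. by apply: (mulgI (f 1)); rewrite -fM !mulg1. Qed.

Let fV y : f y^-1 = (f y)^-1.
Proof. by apply: (mulgI (f y)); rewrite -fM !mulgV. Qed.

(** The bit [e] is chi_k(y): a word representing a trivial image fixes level 5 + k. *)
Lemma lift_kernel_shift y : phi y = 1 -> exists e, tower_shift e (f y).
Proof.
move=> y1; have [w [yw ->]] := fl y; apply: perm_shift_level.
move: yw; rewrite y1 => /esym e.
have /quotg_eqP : quotg_pi (level_subgroup (5 + k)) 1 =
    quotg_pi (level_subgroup (5 + k)) (ev w) by rewrite e gmulf1.
by rewrite invg1 mul1g.
Qed.

Lemma lift_shift_subgroup y y' e e' : tower_shift e (f y) -> tower_shift e' (f y') ->
  tower_shift (e (+) e') (f (y * y'^-1)).
Proof. by move=> sy sy'; rewrite fM fV; apply/perm_shiftM/perm_shiftV. Qed.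

Lemma lift_shift1 : tower_shift false (f 1).
Proof. by rewrite f1; exact: perm_shift1. Qed.

Lemma lift_shiftJ y z e : tower_shift e (f y) -> tower_shift e (f (y ^ z)).
Proof.
move=> sy; have [w [_ fz]] := fl z.
by rewrite /conjg !fM fV fz; exact: perm_shiftJ.
Qed.

(* [Y] lifts the generators of the Grigorchuk group to the free profinite group;
   the lift of a word of the form [v ++ v] does not depend on this choice up to
   [tower_shift false]. *)
Lemma lift_word_shift (Y : gen -> profinite_completion (free_group n)) :
  (forall s, phi (Y s) = to_completion (grig_gen s)) ->
  exists h : pred gen, forall w,
    tower_shift (parity h w)
      ((tower_perm k w)^-1 * f (foldr (fun s y => Y s * y) 1 w))%g.
Proof.
move=> phiY.
have hY s : exists e, tower_shift e (tower_gen_perm k s * f (Y s))%g.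
  have [v [vw ->]] := fl (Y s); apply: (@perm_shift_level _ (s :: v)).
  move: vw; rewrite phiY => /quotg_eqP.
  have -> : (grig_gen s)^-1 = grig_gen s.
    by have := ev_rev [:: s]; rewrite /= mulg1.
  by [].
have [h sh] := choice hY; exists h; elim=> [|s w IH] /=.
  by rewrite f1 invg1 mulg1; exact: perm_shift1.
rewrite fM invgM tower_gen_permV.
(* The error of the first letter is conjugated past the rest of the word, which preserves its
   parity. *)
have := perm_shiftM (perm_shiftJ w (sh s)) IH.
by rewrite /conjg !mulgA mulgK.
Qed.
End NotFinitelyPresented.

Lemma grigorchuk_not_finitely_presented :
  ~ finitely_presented (profinite_completion grigorchuk).
Proof.
move=> [n [phi [S [cphi sphi finS kerphi]]]].
pose f k := sval (cid (tower_lift cphi k)).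
have fP k : [/\ {morph f k : x y / x * y}, forall x, \forall y \near x, f k y = f k x
    & forall x, lifts phi x (f k x)] := svalP (cid (tower_lift cphi k)).
have fM k : {morph f k : x y / x * y} by have [] := fP k.
have fn k x : \forall y \near x, f k y = f k x by have [] := fP k.
have fl k x : lifts phi x (f k x) by have [] := fP k.
have /finite_seqP[r Sr] := finS.
(* The values of chi_k on the list [r] form a boolean tuple of fixed length, so two levels give the
   same tuple. *)
have [k [l [kl sgn]]] := seq_repeat (fun k =>
  [tuple of map (fun y => `[< tower_shift true (f k y) >]) (in_tuple r)]).
(* Agreement of chi_k and chi_l defines a closed normal subgroup; it contains [S], hence the kernel
   of [phi]. *)
pose Z := [set y | exists e, tower_shift e (f k y) /\ tower_shift e (f l y)].
have SZ : S `<=` Z.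
  move=> y Sy; have y1 : phi y = 1.
    have : closed_normal_closure S y by move=> M [_]; apply.
    by rewrite -kerphi.
  have [e ke] := lift_kernel_shift (fl k) y1.
  have [e' le] := lift_kernel_shift (fl l) y1.
  suff ee' : e = e' by exists e; split=> //; rewrite ee'.
  have : `[< tower_shift true (f k y) >] = `[< tower_shift true (f l y) >].
    move: Sy; rewrite Sr /= => yr; have := congr1 val sgn => /= /eq_in_map; exact.
  have shift_true m c (g : {perm fibre m}) :
      tower_shift c g -> `[< tower_shift true g >] = c.
    move=> sg; case: c sg => sg; first exact/asboolP.
    by apply/asboolP => /(tower_shift_inj sg).
  by rewrite (shift_true _ _ _ ke) (shift_true _ _ _ le).
have Zn : is_normal Z.
  split=> [|x g [e [ke le]]]; last by exists e; split; apply: lift_shiftJ.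
  split=> [|x y [e [ke le]] [e' [ke' le']]].
    by exists false; split; exact: lift_shift1.
  by exists (e (+) e'); split; exact: lift_shift_subgroup.
have Zc : closed Z.
  rewrite -[Z]setCK; apply: open_closedC; rewrite openE => x nZ.
  apply: filterS (filterI (fn k x) (fn l x)) => y [/= yk yl] [e]; rewrite yk yl => Zy.
  by apply: nZ; exists e.
have kerZ : phi @^-1` [set 1] `<=` Z.
  by rewrite kerphi => x; apply.
have hY s : exists y, phi y = to_completion (grig_gen s).
  have [] : range phi (to_completion (grig_gen s)) by rewrite sphi.
  by move=> y _ <-; exists y.
have [Y phiY] := choice hY.
pose lift w := foldr (fun s y => Y s * y) 1 w.
have phi_lift w : phi (lift w) = to_completion (ev w).
  elim: w => [|s w IH] /=; first by rewrite !gmulf1.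
  by rewrite !gmulfM IH phiY.
have [e [ke le]] : Z (lift (relator k)).
  apply: kerZ; rewrite /= phi_lift (_ : ev _ = 1) ?gmulf1 //.
  by apply: grig_funP => p; rewrite grig_fun_ev word_fun_relator.
(* The correction from the choice of [Y] has even parity because the relator is a square. *)
have relator_shift m : tower_shift e (f m (lift (relator k))) ->
    tower_shift e (tower_perm m (relator k)).
  move=> me; have [h /(_ (relator k))] := lift_word_shift (fM m) (fl m) phiY.
  have [v rv] := relator_square k.
  rewrite {1}rv parity_cat addbb => /perm_shiftV; rewrite invgM invgK => sh.
  by have := perm_shiftM me sh; rewrite addbF mulgA mulgV mul1g.
have et := tower_shift_inj (relator_shift k ke) (perm_shift_relator k).
have := relator_shift l le; rewrite tower_perm_relator //.
by move=> /tower_shift_inj/(_ (perm_shift1 l)); rewrite et.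
Qed.

(** * Topological generation by a, b, c *)

Lemma grigorchuk_top_generated : top_generated 3 (profinite_completion grigorchuk).
Proof.
pose g (i : 'I_3) := to_completion (grig_gen (nth A [:: A; B; C] i)).
exists g; apply/seteqP; split=> // x _ U /completion_dense[y Uy].
(* The image of the Grigorchuk group is dense, so it is enough that the subgroup generated by a, b,
   c contains it. *)
exists (to_completion y); split=> //; have [w ->] := ev_surj y.
set H := gen_subgroup (range g).
have [H1 HF] : is_subgroup H by exact: gen_subgroupP.
have HM a b : H a -> H b -> H (a * b).
  move=> Ha Hb; rewrite -[b]invgK; apply: (HF) => //.
  by rewrite -[b^-1]mul1g; exact: HF.
have Hg i : H (g i) by move=> M [_]; apply; exists i.
have Hgen s : H (to_completion (grig_gen s)).
  have HA : H (to_completion (grig_gen A)) := Hg ord0.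
  have HB : H (to_completion (grig_gen B)) := Hg (@Ordinal 3 1 isT).
  have HC : H (to_completion (grig_gen C)) := Hg (@Ordinal 3 2 isT).
  case: s => //.
  suff -> : grig_gen D = grig_gen B * grig_gen C by rewrite gmulfM; exact: HM.
  apply: grig_funP => p; rewrite grig_funM !grig_fun_gen /=.
  by have [] := grig_relations p.
elim: w => [|s w IH] /=; first by rewrite gmulf1.
by rewrite gmulfM; exact: HM (Hgen s) IH.
Qed.

Theorem mainTheorem1 :
  [/\ pro_p 2 (profinite_completion grigorchuk),
      top_generated 3 (profinite_completion grigorchuk) &
      ~ finitely_presented (profinite_completion grigorchuk)].
Proof.
split; [|exact: grigorchuk_top_generated|exact: grigorchuk_not_finitely_presented].
by apply: completion_pro_p => //; exact: grig_torsion2.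
Qed.
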